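(* Let $q\in\mathbb{K}\setminus\{0\}$ and $d\in\mathbb{Z}$. The homogeneous averaging operators $P_d^1,P_d^2,P_d^3$ (those operators of the forms listed in the context that are averaging operators) on the $q$-deformed Witt Hom-algebra $(\mathcal{V}^{q},[\cdot,\cdot],\alpha)$ give rise, via $\{x,y\}^i=[P_d^i(x),y]$, to the following Hom-Leibniz algebras $(\mathcal{V}^q,\{\cdot,\cdot\}^i,\alpha)$ on the underlying linear space $\mathcal{V}^q$: for all $m,n\in\mathbb{Z}$, \begin{align*} &\{L_m,L_n\}^{1}=(\beta+\nu\delta_{m+d,0})(m-n)L_{m+n}, && \text{where } q=1 \text{ and } d\in\mathbb{Z},\\ &\{L_m,L_n\}^{2}=\Big(\mu\frac{m}{m+d}\gamma\,\delta_{m,\mathbb{Z}\setminus\{-d\}}\Big)(m-n)L_{m+n}, && \text{where } q=1 \text{ and } d\in\mathbb{Z},\\ &\{L_m,L_n\}^{3}=(\beta+\nu\delta_{q^{m},1})(\{m\}-\{n\})L_{m+n}, && \text{where } q\neq1 \text{ and } q^d=1, \end{align*} where $\beta,\nu\in\mathbb{K}$, $\gamma\in\mathbb{K}\setminus\{0\}$ and $\mu\in\{0,1\}$.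
   Context: $\mathbb{K}$ is a field of characteristic zero and $q\in\mathbb{K}\setminus\{0\}$. For $n\in\mathbb{Z}$ put $\{n\}=\frac{1-q^n}{1-q}$ if $q\neq1$ and $\{n\}=n$ if $q=1$. The $q$-deformed Witt Hom-algebra $(\mathcal{V}^q,[\cdot,\cdot],\alpha)$ is the $\mathbb{K}$-vector space with basis $\{L_n\mid n\in\mathbb{Z}\}$, bilinear product $[L_m,L_n]=(\{m\}-\{n\})L_{m+n}$ and linear map $\alpha(L_n)=(1+q^n)L_n$; it is $\mathbb{Z}$-graded with $\mathcal{V}^q_n=\mathbb{K}L_n$. An averaging operator on a Hom-algebra $(A,[\cdot,\cdot],\alpha)$ (a vector space with a bilinear product and a linear map $\alpha:A\to A$) is a linear map $P:A\to A$ with $\alpha\circ P=P\circ\alpha$ and $[P(x),P(y)]=P([P(x),y])=P([x,P(y)])$ for all $x,y\in A$. It is homogeneous with degree $d$ if $P(\mathcal{V}^q_m)\subseteq\mathcal{V}^q_{m+d}$ for all $m\in\mathbb{Z}$. A Hom-Leibniz algebra is a Hom-algebra $(A,\{\cdot,\cdot\},\alpha)$ with $\{\alpha(x),\{y,z\}\}=\{\{x,y\},\alpha(z)\}+\{\alpha(y),\{x,z\}\}$ for all $x,y,z\in A$. The operators are, for all $m\in\mathbb{Z}$: $P_d^1(L_m)=(\beta+\nu\delta_{m+2d,0})L_{m+d}$ (for $q=1$, $d\in\mathbb{Z}$); $P_d^2(L_m)=\mu\frac{m+d}{m+2d}\gamma\,\delta_{m+d,\mathbb{Z}\setminus\{-d\}}L_{m+d}$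 (for $q=1$, $d\in\mathbb{Z}$); $P_d^3(L_m)=(\beta+\nu\delta_{q^m,1})L_{m+d}$ (for $q\neq1$, $q^d=1$), with $\beta,\nu\in\mathbb{K}$, $\gamma\in\mathbb{K}\setminus\{0\}$, $\mu\in\{0,1\}$. Here $\delta_{x,y}=1$ if $x=y$ and $0$ otherwise; $\delta_{m,\mathbb{Z}\setminus\{-d\}}=1$ if $m\neq-d$ and $0$ if $m=-d$; an expression containing this factor is read as $0$ when the factor vanishes.
   Formalization: The printed table contradicts {x,y}=[P(x),y] when d≠0 (q=1, d=1, β=0, ν=1: {L_{-2},L_0}=-L_{-1}, but the table gives 0); the left-hand sides are corrected to {L_{m-d},L_n}, keeping every right-hand side; for d=0 this is the printed table. *)

(* Defs.v *)
From HB Require Import structures.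
From mathcomp Require Import all_boot all_order all_algebra.
From mathcomp Require Import finmap.
From mathcomp Require Import monalg.

Set Implicit Arguments.
Unset Strict Implicit.
Unset Printing Implicit Defensive.

Import GRing.Theory.
Local Open Scope ring_scope.

Section HomAlgebras.
Variables (K : fieldType) (A : lmodType K).
Implicit Types (br : A -> A -> A) (al P : A -> A).

Definition hom_algebra br al : Prop :=
  [/\ forall x : A, linear (br x),
      forall y : A, linear (fun x => br x y)
    & linear al].

Definition averaging br al P : Prop :=
  [/\ linear P,
      forall x, al (P x) = P (al x)
    & forall x y, br (P x) (P y) = P (br (P x) y) /\
                  P (br (P x) y) = P (br x (P y))].

Definition hom_Leibniz br al : Prop :=
  hom_algebra br al /\
  forall x y z, br (al x) (br y z) = br (br x y) (al z) + br (al y) (br x z).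

End HomAlgebras.

Section Witt.
Variable K : fieldType.

(* Finitely supported functions int -> K, with their K-module structure. *)
Local Notation V := {malg K[int]}.

Definition L (n : int) : V := << n >>.

Definition lin_ext (f : int -> V) (x : V) : V :=
  \sum_(m <- msupp x) x@_m *: f m.

Variable q : K.

Definition qnum (n : int) : K :=
  if q == 1 then n%:~R else (1 - q ^ n) / (1 - q).

Definition witt_br (x y : V) : V :=
  lin_ext (fun m => lin_ext (fun n => (qnum m - qnum n) *: L (m + n)) y) x.

Definition witt_al : V -> V := lin_ext (fun n => (1 + q ^ n) *: L n).

Definition witt_comp (n : int) (x : V) : Prop := exists c : K, x = c *: L n.

Definition homogeneous (d : int) (P : V -> V) : Prop :=
  forall (m : int) (x : V), witt_comp m x -> witt_comp (m + d) (P x).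

Definition homogeneous_averaging (d : int) (P : V -> V) : Prop :=
  averaging witt_br witt_al P /\ homogeneous d P.

End Witt.

Section Operators.
Variable K : fieldType.
Implicit Types (beta nu gamma mu : K) (d : int).

Definition P1 beta nu d : {malg K[int]} -> {malg K[int]} :=
  lin_ext (fun m => (beta + nu * (m + 2 * d == 0)%:R) *: L K (m + d)).

(* When m + 2 * d = 0 the last factor is 0, and so is the whole coefficient,
   whatever the value given to the division by 0. *)
Definition P2 gamma mu d : {malg K[int]} -> {malg K[int]} :=
  lin_ext (fun m =>
    (mu * ((m + d)%:~R / (m + 2 * d)%:~R) * gamma * (m + d != - d)%:R)
      *: L K (m + d)).

Definition P3 (q : K) beta nu d : {malg K[int]} -> {malg K[int]} :=
  lin_ext (fun m => (beta + nu * (q ^ m == 1)%:R) *: L K (m + d)).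

End Operators.

(* The product {x, y} = [P x, y].  As P raises degrees by d, its structure
   constants take their simplest form on the pairs (L (m - d), L n), m being
   the degree of P (L (m - d)). *)
Definition derived_br (K : fieldType) (q : K)
    (P : {malg K[int]} -> {malg K[int]}) (x y : {malg K[int]}) : {malg K[int]} :=
  witt_br q (P x) y.

(* Main.v *)
Require Import Defs.
From HB Require Import structures.
From mathcomp Require Import all_boot all_order all_algebra.
From mathcomp Require Import finmap.
From mathcomp Require Import monalg.
From mathcomp Require Import ring.

Set Implicit Arguments.
Unset Strict Implicit.
Unset Printing Implicit Defensive.

Import GRing.Theory.
Local Open Scope ring_scope.

(** The product [{x, y} = [P x, y]] is the general way in which an averaging
    operator [P] on a Hom-Leibniz algebra produces a new Hom-Leibniz product
    ([averaging_derived_hom_Leibniz]).  Put [X = P x] and [Y = P y].  Since [P]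
    commutes with [al], two of the three terms of the identity for the derived
    product are visibly terms of the identity of the original product at
    [(X, Y, z)]; the third contains [P [P x, y]], which the averaging condition
    turns into [[X, Y]].

    What has to be known about the Witt Hom-algebra is therefore only that it
    is itself Hom-Leibniz ([witt_hom_Leibniz]).  Its product is antisymmetric,
    so this is a form of the Hom-Jacobi identity.  By trilinearity it reduces
    to basis vectors, where it is a polynomial identity in [q ^ l], [q ^ m]
    and [q ^ n] (in the images of [l], [m] and [n] in [K] if [q = 1]).

    The structure constants follow from evaluating [P] at [L (m - d)], which
    is a multiple of [L m]. *)

Lemma averaging_derived_hom_Leibniz (K : fieldType) (A : lmodType K)
    (br : A -> A -> A) (al P : A -> A) :
  hom_Leibniz br al -> averaging br al P ->
  hom_Leibniz (fun x y => br (P x) y) al.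
Proof.
move=> [[br_linr br_linl al_lin] leib] [P_lin alP avg]; split.
  by split=> // y a u v; rewrite P_lin br_linl.
by move=> x y z; rewrite -!alP leib (avg x y).1.
Qed.

Section LinearExtension.
Variable K : fieldType.
Local Notation V := {malg K[int]}.
Implicit Types (f : int -> V) (x y : V).

(** Enlarging the range of summation beyond the support makes [lin_ext f x]
    and [lin_ext f y] comparable over a common range, whence linearity. *)
Lemma lin_extEw (D : {fset int}) f x : (msupp x `<=` D)%fset ->
  lin_ext f x = \sum_(m <- D) x@_m *: f m.
Proof.
move=> le_xD; apply: big_fset_incl => // m _ m_notin_x.
by rewrite mcoeff_outdom // scale0r.
Qed.

Lemma lin_ext_linear f : linear (lin_ext f).
Proof.
move=> a x y; pose D := (msupp x `|` msupp y)%fset.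
have le_xD : (msupp x `<=` D)%fset by apply: fsubsetUl.
have le_yD : (msupp y `<=` D)%fset by apply: fsubsetUr.
have le_axyD : (msupp (a *: x + y) `<=` D)%fset.
  apply: (fsubset_trans (msuppD_le _ _)).
  by rewrite fsubUset le_yD (fsubset_trans (msuppZ_le _ _)).
rewrite (lin_extEw f le_axyD) (lin_extEw f le_xD) (lin_extEw f le_yD).
rewrite scaler_sumr -big_split /=.
by apply: eq_bigr => m _; rewrite mcoeffD mcoeffZ scalerDl scalerA.
Qed.

Lemma lin_extL f n : lin_ext f (L K n) = f n.
Proof.
by rewrite (lin_extEw f msuppU_le) big_seq_fset1 mcoeffUU scale1r.
Qed.

(** Used for the second argument of a bilinear extension: the scalar that [g]
    lets out has to move past the coefficients of [x]. *)
Lemma lin_ext_linear_fun (g : int -> V -> V) x :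
  (forall m, linear (g m)) -> linear (fun y => lin_ext (g^~ y) x).
Proof.
move=> g_lin a u v; rewrite /lin_ext scaler_sumr -big_split /=.
by apply: eq_bigr => m _; rewrite g_lin scalerDr !scalerA mulrC.
Qed.

(** Identities between multilinear expressions are checked on the basis by
    applying this to one argument at a time.  Closure under [a *: x + y] is
    stability under sums, scaling and zero at once, as [0 = -1 *: x + x]. *)
Lemma basis_ind (Q : V -> Prop) :
  (forall a x y, Q x -> Q y -> Q (a *: x + y)) -> (forall n, Q (L K n)) ->
  forall x, Q x.
Proof.
move=> Q_lin Q_L x; rewrite (monalgE x).
have Q0 : Q 0 by rewrite -(addNr (L K 0)) -scaleN1r; apply: Q_lin.
apply: big_ind => [//|y z Qy Qz|n _].
  by rewrite -[y]scale1r; apply: Q_lin.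
have ->: << x@_n *g n >> = x@_n *: L K n + 0.
  by apply/malgP=> k; rewrite addr0 mcoeffZ !mcoeffU mulrnAr mulr1.
exact: Q_lin.
Qed.

End LinearExtension.

Section WittHomLeibniz.
Variables (K : fieldType) (q : K).
Local Notation V := {malg K[int]}.
Local Notation br := (witt_br q).
Local Notation al := (witt_al q).

Lemma witt_brLL m n :
  br (L K m) (L K n) = (qnum q m - qnum q n) *: L K (m + n).
Proof. by rewrite /witt_br !lin_extL. Qed.

Lemma witt_alL n : al (L K n) = (1 + q ^ n) *: L K n.
Proof. exact: lin_extL. Qed.

Lemma witt_hom_algebra : hom_algebra br al.
Proof.
split=> [x|y|]; last exact: lin_ext_linear.
  by apply: lin_ext_linear_fun => m; apply: lin_ext_linear.
exact: lin_ext_linear.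
Qed.

(** If [q != 1], each [qnum q k] is [1 - q ^ k] times the same constant
    [(1 - q)^-1], so this is an identity between polynomials in that constant
    and in [q ^ l], [q ^ m], [q ^ n].  If [q = 1], it is one between polynomials
    in the images of [l], [m] and [n]. *)
Lemma qnum_hom_Leibniz (q_neq0 : q != 0) (l m n : int) :
  (1 + q ^ l) * (qnum q m - qnum q n) * (qnum q l - qnum q (m + n)) =
  (qnum q l - qnum q m) * (1 + q ^ n) * (qnum q (l + m) - qnum q n) +
  (1 + q ^ m) * (qnum q l - qnum q n) * (qnum q m - qnum q (l + n)).
Proof.
rewrite /qnum; case: eqVneq => [->|_].
  by rewrite !exp1rz !rmorphD /=; ring.
by rewrite !expfzDr //; ring.
Qed.

Lemma witt_hom_Leibniz : q != 0 -> hom_Leibniz br al.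
Proof.
move=> q_neq0; split; first exact: witt_hom_algebra.
have [br_linr br_linl al_lin] := witt_hom_algebra.
have brZr a x y : br x (a *: y) = a *: br x y.
  exact: (GRing.scalable_linear (br_linr x)).
have brZl a x y : br (a *: x) y = a *: br x y.
  exact: (GRing.scalable_linear (br_linl y)).
apply: basis_ind => [a u v IHu IHv y z|l].
  by rewrite !(al_lin, br_linl, br_linr) IHu IHv scalerDr addrACA.
apply: basis_ind => [a u v IHu IHv z|m].
  by rewrite !(al_lin, br_linl, br_linr) IHu IHv scalerDr addrACA.
apply: basis_ind => [a u v IHu IHv|n].
  by rewrite !(al_lin, br_linl, br_linr) IHu IHv scalerDr addrACA.
rewrite !(witt_alL, witt_brLL, brZl, brZr) !scalerA.
by rewrite -addrA (addrCA m l n) -scalerDl -qnum_hom_Leibniz.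
Qed.

(** The three operators are instances of one shape, the shift of degrees by
    [d] weighted by coefficients [c]; this gives all the structure constants
    at once. *)
Lemma derived_br_shiftL (c : int -> K) (d m n : int) :
  derived_br q (lin_ext (fun k => c k *: L K (k + d))) (L K (m - d)) (L K n) =
  (c (m - d) * (qnum q m - qnum q n)) *: L K (m + n).
Proof.
have [_ br_linl _] := witt_hom_algebra.
rewrite /derived_br lin_extL subrK (GRing.scalable_linear (br_linl _)) /=.
by rewrite witt_brLL scalerA.
Qed.

End WittHomLeibniz.

Lemma qnum1B (K : fieldType) (m n : int) :
  qnum (1 : K) m - qnum 1 n = (m - n)%:~R.
Proof. by rewrite /qnum eqxx rmorphB. Qed.

Theorem theorem3p8 (K : fieldType) (charK : [pchar K] =i pred0)
    (q : K) (q_neq0 : q != 0) (d : int)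
    (beta nu gamma mu : K) (gamma_neq0 : gamma != 0)
    (mu01 : mu = 0 \/ mu = 1) :
  [/\ q = 1 ->
      homogeneous_averaging q d (P1 beta nu d) ->
        hom_Leibniz (derived_br q (P1 beta nu d)) (witt_al q) /\
        forall m n : int,
          derived_br q (P1 beta nu d) (L K (m - d)) (L K n) =
          ((beta + nu * (m + d == 0)%:R) * (m - n)%:~R) *: L K (m + n),

      q = 1 ->
      homogeneous_averaging q d (P2 gamma mu d) ->
        hom_Leibniz (derived_br q (P2 gamma mu d)) (witt_al q) /\
        forall m n : int,
          derived_br q (P2 gamma mu d) (L K (m - d)) (L K n) =
          ((mu * (m%:~R / (m + d)%:~R) * gamma * (m != - d)%:R)
             * (m - n)%:~R) *: L K (m + n)

    & q != 1 -> q ^ d = 1 ->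
      homogeneous_averaging q d (P3 q beta nu d) ->
        hom_Leibniz (derived_br q (P3 q beta nu d)) (witt_al q) /\
        forall m n : int,
          derived_br q (P3 q beta nu d) (L K (m - d)) (L K n) =
          ((beta + nu * (q ^ m == 1)%:R) * (qnum q m - qnum q n))
             *: L K (m + n)].
Proof.
have derived_Leibniz P :
    homogeneous_averaging q d P -> hom_Leibniz (derived_br q P) (witt_al q).
  move=> [P_avg _].
  exact: averaging_derived_hom_Leibniz (witt_hom_Leibniz q_neq0) P_avg.
have shift2 m : m - d + 2 * d = m + d by ring.
split=> [q1|q1|_ qd1] P_havg; split; try exact: derived_Leibniz.
all: move=> m n; rewrite derived_br_shiftL.
- by rewrite q1 qnum1B shift2.
- by rewrite q1 qnum1B shift2 subrK.
by rewrite expfzDr // -invr_expz qd1 invr1 mulr1.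
Qed.
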